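(* For all integers $a,b\geq 3$ there is a secure and informative protocol for card deals of size $(a,b,1)$.
   Context: Cards are the integers $0,\dots,d-1$ with $d=a+b+1$. A deal of size $(a,b,c)$ is a triple $(A,B,C)$ of pairwise disjoint subsets of $\{0,\dots,d-1\}$ of sizes $a,b,c$ held by Alice, Bob and Cath respectively; initially each player knows only her own hand and the sizes. A protocol is a finite sequence of public, truthful announcements by Alice and Bob (here: one announcement by Alice followed by one by Bob), where an announcement by a player is a set of possible hands of that player containing her actual hand, chosen as a function of her own hand; its effect is to restrict the set of possible deals to those in which that player holds one of the announced hands. A player knows that a player holds card $z$ if this holds in all deals consistent with the announcements so far in which the knowing player has her actual hand; a player knows the deal if exactly one such deal remains. The protocol is informative if for every deal, after Alice's announcement Bob knows the deal and after Bob's announcement Alice knows the deal. It is secure if for every deal, after each announcement, Cath does not know for any card $z\notin C$ that Alice holds $z$, nor that Bob holds $z$. *)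

(* Defs.v *)
From mathcomp Require Import all_boot.

Set Implicit Arguments.
Unset Strict Implicit.
Unset Printing Implicit Defensive.

Inductive player := Alice | Bob | Cath.

Section RussianCards.

Variables a b c : nat.

Definition deck := 'I_(a + b + c).
Definition hand := {set deck}.

Definition hand_size (p : player) : nat :=
  match p with Alice => a | Bob => b | Cath => c end.

(* An arbitrary triple of hands; the deals of size (a, b, c) are the triples
   satisfying [is_deal]. *)
Record triple := Triple { aliceH : hand; bobH : hand; cathH : hand }.

Definition hand_of (D : triple) (p : player) : hand :=
  match p with Alice => aliceH D | Bob => bobH D | Cath => cathH D end.

Definition is_deal (D : triple) : Prop :=
  [/\ forall p, #|hand_of D p| = hand_size p,
      [disjoint aliceH D & bobH D],
      [disjoint aliceH D & cathH D]
    & [disjoint bobH D & cathH D]].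

Definition announcement := (player * {set hand})%type.

Fixpoint consistent (anns : seq announcement) (D : triple) : Prop :=
  match anns with
  | [::] => is_deal D
  | (p, X) :: anns' => hand_of D p \in X /\ consistent anns' D
  end.

(* The deals that player [i] considers possible after the announcements [anns]
   when the actual deal is [D]. *)
Definition possible (anns : seq announcement) (i : player) (D D' : triple)
    : Prop :=
  consistent anns D' /\ hand_of D' i = hand_of D i.

Definition knows_holds (anns : seq announcement) (i : player) (D : triple)
    (p : player) (z : deck) : Prop :=
  forall D', possible anns i D D' -> z \in hand_of D' p.

Definition knows_deal (anns : seq announcement) (i : player) (D : triple)
    : Prop :=
  exists! D', possible anns i D D'.

(* What player [p] announces, as a function of the hand of [p] alone: a set of
   hands of the right size that contains the actual hand. *)
Definition truthful (p : player) (f : hand -> {set hand}) : Prop :=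
  forall H : hand, #|H| = hand_size p ->
    H \in f H /\ (forall H' : hand, H' \in f H -> #|H'| = hand_size p).

Record protocol := Protocol {
  alice_says : hand -> {set hand};
  bob_says : hand -> {set hand};
  alice_truthful : truthful Alice alice_says;
  bob_truthful : truthful Bob bob_says
}.

Definition after_alice (P : protocol) (D : triple) : seq announcement :=
  [:: (Alice, alice_says P (aliceH D))].

Definition after_bob (P : protocol) (D : triple) : seq announcement :=
  rcons (after_alice P D) (Bob, bob_says P (bobH D)).

Definition informative (P : protocol) : Prop :=
  forall D, is_deal D ->
    knows_deal (after_alice P D) Bob D /\ knows_deal (after_bob P D) Alice D.

Definition cath_ignorant (anns : seq announcement) (D : triple) : Prop :=
  forall z : deck, z \notin cathH D ->
    ~ knows_holds anns Cath D Alice z /\ ~ knows_holds anns Cath D Bob z.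

Definition secure (P : protocol) : Prop :=
  forall D, is_deal D ->
    cath_ignorant (after_alice P D) D /\ cath_ignorant (after_bob P D) D.

End RussianCards.

(* Main.v *)
Require Import Defs.
From mathcomp Require Import all_boot ssralg finalg zmodp zify.

(** Label the cards by the residues modulo [n = a + b + 1]. Alice announces the
    sum of her hand, and Bob does the same. The sum of the whole deck is known,
    so each of them can then compute Cath's single card. Bob's announcement
    tells Cath nothing new, as she can compute his sum from Alice's sum and her
    own card. For security it remains to see that, if [E] consists of Cath's
    card and one other card, then every residue is the sum of a [k]-subset
    avoiding [E], for the relevant [k]. This is a statement about a finite
    abelian group: up to complementation [2 k + 2 <= n], and then elements can
    be chosen one by one, adding each to [E], until two or three are left to
    choose. *)

Set Implicit Arguments.
Unset Strict Implicit.
Unset Printing Implicit Defensive.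

Import GRing.Theory.

Lemma exists_notin (T : finType) (A : {set T}) :
  #|A| < #|T| -> exists x, x \notin A.
Proof.
rewrite -cardsT => ltAT; have /subsetPn[x _ xA] : ~~ ([set: T] \subset A).
  by apply: contraL ltAT => /subset_leq_card; rewrite -leqNgt.
by exists x.
Qed.

Lemma cardsU_disjoint (T : finType) (A B : {set T}) :
  [disjoint A & B] -> #|A :|: B| = #|A| + #|B|.
Proof. by move=> dAB; rewrite -cardsUI disjoint_setI0 // cards0 addn0. Qed.

Lemma disjointsUl (T : finType) (A B C : {set T}) :
  [disjoint A :|: B & C] = [disjoint A & C] && [disjoint B & C].
Proof. by rewrite -!setI_eq0 setIUl setU_eq0. Qed.

Lemma eq_setCU_disjoint (T : finType) (A B C : {set T}) :
  [disjoint A & B] -> [disjoint A & C] -> [disjoint B & C] ->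
  #|A| + #|B| + #|C| = #|T| -> A = ~: (B :|: C).
Proof.
move=> dAB dAC dBC cardABC; apply/eqP; rewrite eqEcard -disjoints_subset.
rewrite disjoint_sym disjointsUl ![[disjoint _ & A]]disjoint_sym dAB dAC /=.
by have := cardsC (B :|: C); rewrite cardsU_disjoint //; lia.
Qed.

Section SumAvoiding.

Variables (T : finType) (G : zmodType) (f : T -> G).
Implicit Types (E A : {set T}) (u : G) (k : nat).

Definition sum_avoiding E k u : Prop := exists A : {set T},
  [/\ [disjoint A & E], #|A| = k & (\sum_(x in A) f x)%R = u].

Lemma sum_avoidingU1 E k u x :
  x \notin E -> sum_avoiding (x |: E) k (u - f x)%R -> sum_avoiding E k.+1 u.
Proof.
move=> xE [A [dA cA sA]].
have xA : x \notin A by rewrite (disjointFl dA) ?setU11.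
exists (x |: A); split; last by rewrite big_setU1 //= sA addrC subrK.
  by rewrite disjointsUl disjoints1 xE (disjointWr _ dA) ?subsetUr.
by rewrite cardsU1 xA cA.
Qed.

Lemma sum_avoidingC E j k u :
  j + k + #|E| = #|T| -> sum_avoiding E j (\sum_(x in ~: E) f x - u)%R ->
  sum_avoiding E k u.
Proof.
move=> cardT [A [dA cA sA]]; exists (~: E :\: A); split.
- by rewrite disjoints_subset subDset subsetUr.
- by rewrite cardsDS -?disjoints_subset //; have := cardsC E; lia.
have /setIidPr AE : A \subset ~: E by rewrite -disjoints_subset.
by apply: (@addrI _ (\sum_(x in A) f x)%R); rewrite -{1}AE -big_setID sA subrK.
Qed.

End SumAvoiding.

Lemma sum_avoiding_bij (T : finType) (G : finZmodType) (f : T -> G)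
    (E : {set T}) (k : nat) (u : G) :
  bijective f -> sum_avoiding id (f @: E) k u -> sum_avoiding f E k u.
Proof.
move=> bij_f [A [dA cA sA]]; exists (f @^-1: A); split.
- apply/pred0P=> x /=; rewrite inE; apply/andP=> -[fxA xE].
  by have := disjointFr dA fxA; rewrite imset_f.
- by rewrite on_card_preimset //; apply: onW_bij.
rewrite -sA (reindex f) /=; last exact: onW_bij.
by apply: eq_bigl => x; rewrite inE.
Qed.

Section Halves.

Variable G : finZmodType.
Implicit Types (E : {set G}) (u x : G) (k : nat).

Definition halves u : {set G} := [set x | x + x == u]%R.

Definition doubles : {set G} := [set x + x | x : G]%R.

Lemma card_halves_double x : #|halves (x + x)%R| = #|halves 0%R|.
Proof.
rewrite -(card_imset (mem (halves 0%R)) (addrI x)).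
apply: eq_card => y; rewrite inE.
apply/eqP/imsetP=> [eq_yx | [t]]; last first.
  by rewrite inE => /eqP t0 ->; rewrite addrACA t0 addr0.
by exists (y - x)%R; rewrite ?inE 1?addrC ?subrK // addrACA eq_yx -opprD subrr.
Qed.

Lemma card_halves_le u : #|halves u| <= #|halves 0%R|.
Proof.
have [->|[x]] := set_0Vmem (halves u); first by rewrite cards0.
by rewrite inE => /eqP<-; rewrite card_halves_double.
Qed.

Lemma halves_eq0 u : u \notin doubles -> halves u = set0.
Proof.
move=> udbl; apply/setP=> x; rewrite !inE; apply: contraNF udbl => /eqP<-.
exact: imset_f.
Qed.

Lemma card_doubles : #|doubles| * #|halves 0%R| = #|G|.
Proof.
rewrite -(sum1_card G) (partition_big_imset (fun x : G => x + x)%R) /=.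
rewrite -sum_nat_const; apply: eq_bigr => _ /imsetP[x _ ->].
rewrite -(card_halves_double x) -sum1_card.
by apply: eq_bigl => y; rewrite inE.
Qed.

(* [x] and [u - x] are the required elements unless [x] lies in [E], in [u - E],
   or is a half of [u]. *)
Lemma sum_avoiding2 E u :
  #|E|.*2 + #|halves u| < #|G| -> sum_avoiding id E 2 u.
Proof.
move=> small; pose r x := (u - x)%R.
have r_inj : injective r by move=> x y /addrI/oppr_inj.
have /exists_notin[x] : #|(E :|: r @^-1: E) :|: halves u| < #|G|.
  have := leq_card_setU (E :|: r @^-1: E) (halves u).
  have := leq_card_setU E (r @^-1: E).
  by rewrite (card_preimset E r_inj) => -[le_pair _] [le_bad _]; lia.
rewrite !inE !negb_or -andbA => /and3P[xE rxE xhalf].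
have neq_xr : x != r x.
  by apply: contra xhalf => /eqP e; rewrite {2}e addrC subrK.
exists [set x; r x]; split.
- by rewrite disjointsUl !disjoints1 xE.
- by rewrite cards2 neq_xr.
by rewrite big_setU1 ?inE //= big_set1 addrC subrK.
Qed.

(* If doubling is injective, [u - x] has a single half for any [x]. Otherwise at
   most half of the elements are doubles, and [x] is chosen so that [u - x] is
   not one of them. *)
Lemma sum_avoiding3 E u : #|E|.*2 + 4 <= #|G| -> sum_avoiding id E 3 u.
Proof.
move=> leE; have [x xE few] : exists2 x,
    x \notin E & #|halves (u - x)%R| <= 1; last first.
  have room : #|x |: E|.*2 + #|halves (u - x)%R| < #|G|.
    by rewrite cardsU1 xE; lia.
  exact: sum_avoidingU1 xE (sum_avoiding2 room).
have := card_doubles; case: (leqP #|halves 0%R| 1) => [le1 _|gt1 dbl].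
  have /exists_notin[x xE] : #|E| < #|G| by lia.
  by exists x; rewrite // (leq_trans (card_halves_le _)).
pose D := [set (u - y)%R | y in doubles].
have cardD : #|D| = #|doubles| by apply: card_imset => x y /addrI/oppr_inj.
have /exists_notin[x] : #|E :|: D| < #|G|.
  have half_doubles : #|doubles|.*2 <= #|G|.
    by rewrite -dbl -muln2 leq_mul2l gt1 orbT.
  by have [+ _] := leq_card_setU E D; rewrite cardD; lia.
rewrite inE negb_or => /andP[xE xD]; exists x => //.
rewrite halves_eq0 ?cards0 //; apply: contra xD => xdbl.
by apply/imsetP; exists (u - x)%R; rewrite // subKr.
Qed.

Lemma sum_avoiding_small E k u :
  3 <= k -> (k + #|E|).*2 <= #|G| + 2 -> sum_avoiding id E k u.
Proof.
move=> /subnK <-; elim: (k - 3) E u => {k} [|k IHk] E u; rewrite ?addSn => leE.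
  by apply: sum_avoiding3; lia.
have /exists_notin[x xE] : #|E| < #|G| by lia.
apply: (sum_avoidingU1 xE); apply: IHk.
by rewrite cardsU1 xE; lia.
Qed.

Lemma sum_avoiding_le2 E k u :
  #|E| <= 2 -> #|E|.*2 + #|halves 0%R| < #|G| ->
  2 <= k -> k + #|E| + 2 <= #|G| -> sum_avoiding id E k u.
Proof.
move=> E_le2 small k_ge2 k_le.
wlog k_small : k u k_ge2 k_le / (k + #|E|).*2 <= #|G| + 2.
  move=> small_case.
  case: leqP (small_case k u k_ge2 k_le) => [_|k_big _]; first exact.
  have card_split : #|G| - #|E| - k + k + #|E| = #|G| by lia.
  by apply: (sum_avoidingC card_split); apply: small_case; lia.
have [k_gt2|k_le2] := ltnP 2 k; first exact: sum_avoiding_small.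
have -> : k = 2 by lia.
by apply/sum_avoiding2/leq_ltn_trans/small; rewrite leq_add2l card_halves_le.
Qed.

End Halves.

Lemma card_halves0_ord (n : nat) : #|halves (0%R : 'I_n.+1)| <= 2.
Proof.
set H := halves _.
have val_half x : x \in H -> x = 0 :> nat \/ x + x = n.+1.
  rewrite inE => /eqP/(congr1 val) /= xx0; have := divn_eq (x + x) n.+1.
  by rewrite xx0; have := ltn_ord x; case: (_ %/ _) => [|[|q]]; nia.
have inj_pos : {in H &, injective (fun x : 'I_n.+1 => 0 < x)}.
  by move=> x y /val_half hx /val_half hy e; apply: val_inj => /=; lia.
by rewrite -(card_in_imset inj_pos) (leq_trans (max_card _)) // card_bool.
Qed.

Section Deals.

Variables a b c : nat.

Local Notation triple := (triple a b c).
Local Notation hand := (hand a b c).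
Implicit Types (D : triple) (A C : hand).

Lemma deal_card D : is_deal D ->
  #|aliceH D| + #|bobH D| + #|cathH D| = #|deck a b c|.
Proof.
by case=> cD _ _ _; rewrite (cD Alice) (cD Bob) (cD Cath) card_ord.
Qed.

Lemma deal_aliceE D : is_deal D -> aliceH D = ~: (bobH D :|: cathH D).
Proof.
by move=> dD; have cD := deal_card dD; case: dD => *; apply: eq_setCU_disjoint.
Qed.

Lemma deal_bobE D : is_deal D -> bobH D = ~: (aliceH D :|: cathH D).
Proof.
move=> dD; have := deal_card dD; case: dD => _ dAB dAC dBC.
rewrite (addnC #|aliceH D|).
by apply: eq_setCU_disjoint; rewrite // disjoint_sym.
Qed.

Lemma deal_eq D D' : is_deal D -> is_deal D' -> cathH D' = cathH D ->
  aliceH D' = aliceH D \/ bobH D' = bobH D -> D = D'.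
Proof.
move=> dD dD' eC eAB; have eA : aliceH D' = aliceH D.
  by case: eAB => // eB; rewrite (deal_aliceE dD) (deal_aliceE dD') eB eC.
have := deal_bobE dD; rewrite -eA -eC -(deal_bobE dD').
by case: D D' {dD dD' eAB} eA eC => A B C [A' B' C'] /= -> -> ->.
Qed.

Lemma is_deal_complement A C : #|A| = a -> #|C| = c -> [disjoint A & C] ->
  is_deal (Triple A (~: (A :|: C)) C).
Proof.
move=> cA cC dAC; split=> //=.
- by case=> //=; rewrite cardsCs setCK card_ord cardsU_disjoint // cA cC; lia.
- by rewrite disjoints_subset setCK subsetUl.
by rewrite disjoints_subset setCS subsetUr.
Qed.

Lemma consistent_rcons (anns : seq (announcement a b c)) p X D :
  consistent (rcons anns (p, X)) D <-> hand_of D p \in X /\ consistent anns D.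
Proof. by elim: anns => [|[q Y] anns IH] //=; rewrite IH; tauto. Qed.

Lemma cath_ignorant_rcons (anns : seq (announcement a b c)) ann D :
  cath_ignorant (rcons anns ann) D -> cath_ignorant anns D.
Proof.
case: ann => p X ign z /ign[nA nB].
by split=> kn; [apply: nA | apply: nB] => D' [/consistent_rcons[_ cD'] eC];
   apply: kn.
Qed.

End Deals.

Section SumProtocol.

Variables (a b c : nat) (G : finZmodType) (label : deck a b c -> G).

Local Notation triple := (triple a b c).
Local Notation hand := (hand a b c).
Implicit Types (D : triple) (A H : hand).

Definition hand_sum H : G := (\sum_(x in H) label x)%R.

Definition same_sum (p : player) H : {set hand} :=
  [set H' : hand | (#|H'| == hand_size a b c p) && (hand_sum H' == hand_sum H)].

Lemma same_sum_truthful p : truthful p (same_sum p).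
Proof.
by move=> H cH; split=> [|H']; rewrite !inE ?cH ?eqxx // => /andP[/eqP].
Qed.

Definition sum_protocol : protocol a b c :=
  Protocol (@same_sum_truthful Alice) (@same_sum_truthful Bob).

Lemma deal_sum D : is_deal D ->
  (hand_sum (aliceH D) + hand_sum (bobH D) + hand_sum (cathH D)
   = \sum_x label x)%R.
Proof.
move=> dD; rewrite (deal_bobE dD) addrAC; case: dD => _ _ dAC _.
rewrite (bigID (mem (aliceH D :|: cathH D))) /=; congr (_ + _)%R.
  by rewrite -bigU //; apply: eq_bigl => x; rewrite !inE.
by apply: eq_bigl => x; rewrite inE.
Qed.

Lemma mem_same_sum p D D' : is_deal D' ->
  (hand_of D' p \in same_sum p (hand_of D p))
  = (hand_sum (hand_of D' p) == hand_sum (hand_of D p)).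
Proof. by case=> cD' _ _ _; rewrite inE cD' eqxx. Qed.

Lemma consistent_after_alice D D' :
  consistent (after_alice sum_protocol D) D' <->
  is_deal D' /\ hand_sum (aliceH D') = hand_sum (aliceH D).
Proof.
split=> [[/= memA dD']|[dD' eA]].
  by split=> //; apply/eqP; rewrite -(mem_same_sum Alice D dD').
by split=> //=; rewrite (mem_same_sum Alice D dD') /= eA.
Qed.

Lemma consistent_after_bob D D' :
  consistent (after_bob sum_protocol D) D' <->
  [/\ is_deal D', hand_sum (aliceH D') = hand_sum (aliceH D)
    & hand_sum (bobH D') = hand_sum (bobH D)].
Proof.
rewrite consistent_rcons consistent_after_alice.
split=> [[memB [dD' eA]]|[dD' eA eB]].
  by split=> //; apply/eqP; rewrite -(mem_same_sum Bob D dD').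
by split=> //=; rewrite (mem_same_sum Bob D dD') /= eB.
Qed.

Lemma possible_cath_after_bob D D' : is_deal D -> is_deal D' ->
  cathH D' = cathH D -> hand_sum (aliceH D') = hand_sum (aliceH D) ->
  possible (after_bob sum_protocol D) Cath D D'.
Proof.
move=> dD dD' eC eA; split=> //; apply/consistent_after_bob; split=> //.
by have := deal_sum dD'; rewrite -(deal_sum dD) eA eC => /addIr/addrI.
Qed.

End SumProtocol.

Section SingleCard.

Variables (a b : nat) (G : finZmodType) (label : deck a b 1 -> G).
Implicit Types D : triple a b 1.

Lemma cathH_set1 D : is_deal D -> exists x, cathH D = [set x].
Proof. by case=> cD _ _ _; apply/cards1P; rewrite (cD Cath). Qed.

Lemma sum_protocol_informative :
  injective label -> informative (sum_protocol label).
Proof.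
move=> label_inj D dD.
have eq_cath D' : is_deal D' ->
    hand_sum label (aliceH D') = hand_sum label (aliceH D) ->
    hand_sum label (bobH D') = hand_sum label (bobH D) -> cathH D' = cathH D.
  move=> dD' eA eB; have := deal_sum label dD'.
  rewrite -(deal_sum label dD) eA eB => /addrI; have [x ->] := cathH_set1 dD.
  by have [y ->] := cathH_set1 dD'; rewrite /hand_sum !big_set1 => /label_inj->.
split; exists D; split.
- by split=> //; apply/consistent_after_alice.
- move=> D' [/consistent_after_alice[dD' eA] /= eB].
  by apply: deal_eq => //; [apply: eq_cath; rewrite ?eB | right].
- by split=> //; apply/consistent_after_bob.
move=> D' [/consistent_after_bob[dD' _ eB] /= eA].
by apply: deal_eq => //; [apply: eq_cath; rewrite ?eA | left].
Qed.

Hypotheses (a_ge3 : 3 <= a) (b_ge3 : 3 <= b).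
Hypothesis label_bij : bijective label.
Hypothesis halves_le2 : #|halves (0%R : G)| <= 2.

Lemma sum_avoiding_label (x y : deck a b 1) k u :
  x != y -> 2 <= k -> k + 3 <= a + b -> sum_avoiding label [set x; y] k u.
Proof.
move=> neq_xy k_ge2 k_le; apply: sum_avoiding_bij => //.
have card_G : #|G| = a + b + 1 by rewrite -(bij_eq_card label_bij) card_ord.
apply: sum_avoiding_le2 => //;
  by rewrite card_imset ?cards2 ?neq_xy ?card_G; [lia | exact: bij_inj].
Qed.

Lemma exists_alice_hand (x z : deck a b 1) u (holds : bool) : z != x ->
  exists A : {set deck a b 1},
    [/\ #|A| = a, [disjoint A & [set x]], hand_sum label A = u
      & (z \in A) = holds].
Proof.
move=> neq_zx; case: holds; last first.
  have [||A [dA cA sA]] := sum_avoiding_label (k := a) u neq_zx; try lia.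
  by exists A; rewrite (disjointWr _ dA) ?subsetUr // (disjointFl dA) ?set21.
have [||A [dA cA sA]] :=
  sum_avoiding_label (k := a.-1) (u - label z)%R neq_zx; try lia.
have zA : z \notin A by rewrite (disjointFl dA) ?set21.
exists (z |: A); split.
- by rewrite cardsU1 zA cA; lia.
- by rewrite disjointsUl disjoints1 inE neq_zx (disjointWr _ dA) ?subsetUr.
- by rewrite /hand_sum big_setU1 //= sA addrC subrK.
exact: setU11.
Qed.

Lemma sum_protocol_secure : secure (sum_protocol label).
Proof.
move=> D dD; suff ign : cath_ignorant (after_bob (sum_protocol label) D) D.
  by split=> //; apply: cath_ignorant_rcons ign.
have [x eC] := cathH_set1 dD.
move=> z; rewrite {1}eC inE => neq_zx.
have alice_may_hold holds : exists2 D',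
    possible (after_bob (sum_protocol label) D) Cath D D' &
    (z \in aliceH D') = holds.
  have [A [cA dA sA zA]] :=
    exists_alice_hand (hand_sum label (aliceH D)) holds neq_zx.
  exists (Triple A (~: (A :|: cathH D)) (cathH D)) => //.
  apply: possible_cath_after_bob => //.
  by apply: is_deal_complement; rewrite ?eC ?cards1.
split=> knows.
  have [D' posD' zA] := alice_may_hold false.
  by have := knows _ posD'; rewrite /= zA.
have [D' posD' zA] := alice_may_hold true; have := knows _ posD'.
case: posD' => /consistent_after_bob[[_ dAB _ _] _ _] _.
by rewrite /= (disjointFr dAB).
Qed.

End SingleCard.

Theorem mainTheorem8 (a b : nat) (ha : 3 <= a) (hb : 3 <= b) :
  exists P : protocol a b 1, secure P /\ informative P.
Proof.
pose label : deck a b 1 -> 'I_(a + b).+1 := cast_ord (addn1 (a + b)).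
have label_bij : bijective label.
  exists (cast_ord (esym (addn1 (a + b)))); first exact: cast_ordK.
  exact: cast_ordKV.
exists (sum_protocol label); split.
  exact: (sum_protocol_secure ha hb label_bij (card_halves0_ord (a + b))).
exact: (sum_protocol_informative (bij_inj label_bij)).
Qed.
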